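(* Let $\Gamma$ be a two-player perfect-recall extensive-form game, let $\mathcal{V}$ be its von Stengel-Forges polytope, and let $\Xi$ be its polytope of correlation plans. Then $\Xi=\mathcal{V}$ if and only if all vertices of $\mathcal{V}$ have integer $\{0,1\}$ coordinates.
   Context: A (finite) two-player extensive-form game is played on a finite rooted tree. Each nonterminal node belongs to Player 1, Player 2, or the chance player; edges leaving a node represent actions. For $i\in\{1,2\}$, the nodes of Player $i$ are partitioned into nonempty information sets; $\mathcal{I}_i$ is the set of information sets of Player $i$. All nodes of an information set $I$ have the same nonempty action set $A_I$. Sequences: $\Sigma_i=\{(I,a): I\in\mathcal{I}_i, a\in A_I\}\cup\{\varnothing\}$, where $\varnothing$ is the empty sequence. Perfect recall: for each $I\in\mathcal{I}_i$, all nodes of $I$ have the same ordered list of (information set, action) pairs of Player $i$ encountered on the path from the root. The parent sequence $\sigma(I)\in\Sigma_i$ is the last pair $(I',a')$ of Player $i$ encountered on the path from the root to any node of $I$, or $\varnothing$ if there is none. Connectedness: $I_1\in\mathcal{I}_1$ and $I_2\in\mathcal{I}_2$ are connected, $I_1\rightleftharpoons I_2$, if there are nodes $u\in I_1$, $v\in I_2$ such that $u$ is on the path from the root to $v$ or vice versa. Relevance: $(\sigma_1,\sigma_2)\in\Sigma_1\times\Sigma_2$ is relevant, $\sigma_1\bowtie\sigma_2$, if $\sigma_1=\varnothing$ or $\sigma_2=\varnothing$, or $\sigma_1=(I_1,a_1)$, $\sigma_2=(I_2,a_2)$ with $I_1\rightleftharpoons I_2$. $\Sigma_1\bowtie\Sigma_2$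 is the set of relevant pairs. For $\sigma_1\in\Sigma_1$, $I_2\in\mathcal{I}_2$, write $\sigma_1\bowtie I_2$ if $\sigma_1=\varnothing$ or $\sigma_1=(I_1,a_1)$ with $I_1\rightleftharpoons I_2$; define $I_1\bowtie\sigma_2$ symmetrically. The von Stengel-Forges polytope $\mathcal{V}$ is the set of all vectors $v\in\mathbb{R}_{\ge0}^{|\Sigma_1\bowtie\Sigma_2|}$, indexed by relevant sequence pairs, such that: (i) $v[\varnothing,\varnothing]=1$; (ii) $\sum_{a\in A_{I_1}}v[(I_1,a),\sigma_2]=v[\sigma(I_1),\sigma_2]$ for all $I_1\in\mathcal{I}_1$, $\sigma_2\in\Sigma_2$ with $I_1\bowtie\sigma_2$; (iii) $\sum_{a\in A_{I_2}}v[\sigma_1,(I_2,a)]=v[\sigma_1,\sigma(I_2)]$ for all $I_2\in\mathcal{I}_2$, $\sigma_1\in\Sigma_1$ with $\sigma_1\bowtie I_2$. Plans: a reduced-normal-form plan of Player $i$ chooses an action at every information set in $\mathcal{I}_i$ that is still reachable as a result of the plan's own other choices (and only at those); $\Pi_i$ is the set of such plans. For $\sigma\in\Sigma_i$, $\Pi_i(\sigma)$ is the set of plans in $\Pi_i$ that prescribe all actions of Player $i$ on the path from the root down to the information set-action pair $\sigma$ (inclusive); $\Pi_i(\varnothing)=\Pi_i$. Polytope of correlation plans: let $\Delta^{|\Pi_1\times\Pi_2|}$ be the set of probability distributions on $\Pi_1\times\Pi_2$, and let $f:\Delta^{|\Pi_1\times\Pi_2|}\to\mathbb{R}_{\ge0}^{|\Sigma_1\bowtie\Sigma_2|}$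 be the linear map $f(\mu)[\sigma_1,\sigma_2]=\sum_{\pi_1\in\Pi_1(\sigma_1)}\sum_{\pi_2\in\Pi_2(\sigma_2)}\mu(\pi_1,\pi_2)$ for $(\sigma_1,\sigma_2)\in\Sigma_1\bowtie\Sigma_2$. Then $\Xi$ is the image of $f$. *)

(* Defs.v *)
From mathcomp Require Import classical_sets reals.
From mathcomp Require Import all_boot all_order all_algebra.

Set Implicit Arguments.
Unset Strict Implicit.
Unset Printing Implicit Defensive.

Import Order.TTheory GRing.Theory Num.Theory.
Local Open Scope ring_scope.

Notation player := bool (only parsing).
Definition P1 : player := true.
Definition P2 : player := false.

(* [inedge x = Some (h, a)] says that x is the child of h along the edge
   representing action a. *)
Record tree := Tree {
  node : finType;
  act : finType;
  root_node : node;
  inedge : node -> option (node * act);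
  root_inedge : inedge root_node = None;
  root_connect : forall x : node,
    connect [rel u v | omap fst (inedge v) == Some u] root_node x;
  inedge_inj : forall (x y : node) (e : node * act),
    inedge x = Some e -> inedge y = Some e -> x = y
}.

Definition node_actions (T : tree) (h : node T) : {set act T} :=
  [set a | [exists x, inedge x == Some (h, a)]].

Definition terminal (T : tree) (h : node T) : bool := node_actions h == set0.

(* [owner h] is [Some i] if h belongs to Player i and [None] if it belongs to
   chance; it is ignored at terminal nodes. Chance probabilities and payoffs are
   omitted, as the polytopes below do not depend on them. *)
Record game := Game {
  game_tree :> tree;
  owner : node game_tree -> option player;
  infosets : player -> {set {set node game_tree}};
  infosets_partition : forall i : player,
    partition (infosets i)
      [set h | ~~ terminal h & owner h == Some i];
  infosets_same_actions :
    forall (i : player) (I : {set node game_tree}) (h k : node game_tree),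
    I \in infosets i -> h \in I -> k \in I -> node_actions h = node_actions k
}.

Section Game.
Variable G : game.
Implicit Types (i : player) (x h u : node G) (I J : {set node G}) (a : act G).

Definition player_nodes i := [set h : node G | ~~ terminal h & owner h == Some i].

Definition infoset_of i h : {set node G} := pblock (infosets G i) h.

(* All nodes of an information set have the same actions, so the union is the
   common action set. *)
Definition actions I := \bigcup_(h in I) node_actions h.

(* The edges on the path from the root to x, from top to bottom; the fuel
   exceeds the length of any path (see [historyE]). *)
Fixpoint history_rec (n : nat) x : seq (node G * act G) :=
  if n is n'.+1 then
    if inedge x is Some (h, a) then rcons (history_rec n' h) (h, a) else [::]
  else [::].

Definition history x := history_rec #|node G| x.

Definition path_nodes x : seq (node G) := rcons [seq e.1 | e <- history x] x.

Definition own_history i x : seq ({set node G} * act G) :=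
  [seq (infoset_of i e.1, e.2) | e <- history x & e.1 \in player_nodes i].

Definition perfect_recall :=
  forall (i : player) (I : {set node G}) (h k : node G),
    I \in infosets G i -> h \in I -> k \in I -> own_history i h = own_history i k.

(* Under perfect recall, independent of the chosen node
   (see [infoset_historyE]). *)
Definition infoset_history i I : seq ({set node G} * act G) :=
  if [pick h in I] is Some h then own_history i h else [::].

(* [None] is the empty sequence. *)
Definition sequence : finType := option ({set node G} * act G).

Definition sequences i : {set sequence} :=
  None |: [set Some p | p : {set node G} * act G
                        & (p.1 \in infosets G i) && (p.2 \in actions p.1)].

Definition parent_seq i I : sequence :=
  last None [seq Some p | p <- infoset_history i I].

Definition connected (I1 I2 : {set node G}) : bool :=
  [exists u in I1, exists v in I2, (u \in path_nodes v) || (v \in path_nodes u)].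

Definition seq_info_relevant (s1 : sequence) (I2 : {set node G}) : bool :=
  if s1 is Some (I1, _) then connected I1 I2 else true.

Definition info_seq_relevant (I1 : {set node G}) (s2 : sequence) : bool :=
  if s2 is Some (I2, _) then connected I1 I2 else true.

Definition relevant (s1 s2 : sequence) : bool :=
  match s1, s2 with
  | Some (I1, _), Some (I2, _) => connected I1 I2
  | _, _ => true
  end.

Definition relevant_pairs : {set sequence * sequence} :=
  [set p | [&& p.1 \in sequences P1, p.2 \in sequences P2 & relevant p.1 p.2]].

Definition relpair : finType := {p : sequence * sequence | p \in relevant_pairs}.

(* [reachable] refers to infoset_history, which lists the choices strictly
   above I. *)
Definition reachable i (pl : {ffun {set node G} -> option (act G)}) I :=
  all (fun p => pl p.1 == Some p.2) (infoset_history i I).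

(* A plan is a partial choice of actions, [None] standing for "undefined". *)
Definition is_plan i (pl : {ffun {set node G} -> option (act G)}) :=
  [forall I, if (I \in infosets G i) && reachable i pl I
             then [exists a in actions I, pl I == Some a]
             else pl I == None].

Definition plan i : finType :=
  {pl : {ffun {set node G} -> option (act G)} | is_plan i pl}.

Definition seq_path i (s : sequence) : seq ({set node G} * act G) :=
  if s is Some (J, a) then rcons (infoset_history i J) (J, a) else [::].

Definition plans_of i (s : sequence) : {set plan i} :=
  [set pl : plan i | all (fun p => val pl p.1 == Some p.2) (seq_path i s)].

Section Polytopes.
Variable R : realType.

(* R^o is R seen as a module over itself. *)
Definition vec := {ffun relpair -> R^o}.

(* The default value 0 is never used in the definition of the von
   Stengel-Forges polytope (see [info_seq_relevantP] and
   [seq_info_relevantP]). *)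
Definition entry (v : vec) (s1 s2 : sequence) : R :=
  if insub (s1, s2) is Some p then v p else 0.

Definition vonStengelForges : set vec := fun v =>
  [/\ forall p, 0 <= v p,
      entry v None None = 1,
      forall I1 (s2 : sequence),
        I1 \in infosets G P1 -> s2 \in sequences P2 -> info_seq_relevant I1 s2 ->
        \sum_(a in actions I1) entry v (Some (I1, a)) s2
          = entry v (parent_seq P1 I1) s2
    & forall I2 (s1 : sequence),
        I2 \in infosets G P2 -> s1 \in sequences P1 -> seq_info_relevant s1 I2 ->
        \sum_(a in actions I2) entry v s1 (Some (I2, a))
          = entry v s1 (parent_seq P2 I2)].

Definition distributions : set {ffun plan P1 * plan P2 -> R} := fun mu =>
  (forall p, 0 <= mu p) /\ \sum_p mu p = 1.

Definition correlation_map (mu : {ffun plan P1 * plan P2 -> R}) : vec :=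
  [ffun p => \sum_(pl1 in plans_of P1 (val p).1)
              \sum_(pl2 in plans_of P2 (val p).2) mu (pl1, pl2)].

Definition correlation_plans : set vec :=
  (correlation_map @` distributions)%classic.

End Polytopes.
End Game.

Arguments vonStengelForges : clear implicits.
Arguments correlation_plans : clear implicits.

(* The vertices of a polytope, i.e. its extreme points. *)
Definition vertex (R : realType) (E : lmodType R) (A : set E) (x : E) :=
  A x /\ forall (y z : E) (t : R), A y -> A z -> 0 < t < 1 ->
    x = t *: y + (1 - t) *: z -> y = x /\ z = x.

Section Facts.
Variable G : game.
Implicit Types (i : player) (x h u v w : node G) (I J : {set node G}) (a : act G).

Lemma node_path x : exists2 p : seq (node G),
  path [rel u v | omap fst (inedge v) == Some u] (root_node G) p
    && (size p < #|node G|)%N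
  & x = last (root_node G) p.
Proof.
case/connectP: (root_connect x) => p pp ->.
case/shortenP: pp => p' pp' up' _; exists p' => //.
by rewrite pp' /=; apply: (leq_trans _ (max_card (mem (root_node G :: p')))); rewrite (card_uniqP up').
Qed.

Lemma inedgeP h x : omap fst (inedge x) = Some h ->
  exists a, inedge x = Some (h, a).
Proof. by case: (inedge x) => [[k a]|] //= [<-]; exists a. Qed.

Lemma node_ind (P : node G -> Prop) : P (root_node G) ->
  (forall x h a, inedge x = Some (h, a) -> P h -> P x) -> forall x, P x.
Proof.
move=> P0 PS x; have [p /andP[pp _] ->] := node_path x.
elim/last_ind: p pp => //= p y IH; rewrite rcons_path last_rcons /=.
by case/andP=> /IH Ph /eqP /inedgeP [a] /PS; apply.
Qed.

Lemma historyE x : history x =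
  if inedge x is Some (h, a) then rcons (history h) (h, a) else [::].
Proof.
have stable p : path [rel u v | omap fst (inedge v) == Some u] (root_node G) p ->
    forall n m, (size p < n)%N -> (size p < m)%N ->
    history_rec n (last (root_node G) p) = history_rec m (last (root_node G) p).
  elim/last_ind: p => [_ [|n] [|m] //=|p y IH]; first by rewrite root_inedge.
  rewrite rcons_path last_rcons size_rcons /= => /andP[/IH {}IH].
  move=> /eqP /inedgeP [a ya] [|n] [|m] //= ? ?.
  by rewrite ya (IH n m).
have [p /andP[pp sp] ->] := node_path x; rewrite /history.
case E: #|node G| sp => [|m] //; rewrite [LHS]/= ltnS.
elim/last_ind: p pp => [_|p y _]; first by rewrite /= root_inedge.
rewrite rcons_path last_rcons size_rcons /= => /andP[pp].
by case/eqP/inedgeP => a ya sp; rewrite ya (stable p pp m m.+1) // ltnW.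
Qed.

Lemma path_nodesE x : path_nodes x =
  if inedge x is Some (h, a) then rcons (path_nodes h) x else [:: x].
Proof.
rewrite /path_nodes (historyE x); case: (inedge x) => [[h a]|] //=.
by rewrite map_rcons.
Qed.

Lemma path_nodes_refl x : x \in path_nodes x.
Proof. by rewrite mem_rcons mem_head. Qed.

Lemma path_nodes_edge u x h a : inedge x = Some (h, a) ->
  (u \in path_nodes x) = (u == x) || (u \in path_nodes h).
Proof. by move=> xh; rewrite path_nodesE xh mem_rcons inE. Qed.

Lemma path_nodes_trans v u w :
  u \in path_nodes v -> v \in path_nodes w -> u \in path_nodes w.
Proof.
move=> uv; elim/node_ind: w => [|x h a xh IH].
  by rewrite {1}path_nodesE root_inedge inE => /eqP <-.
rewrite (path_nodes_edge v xh) => /predU1P[<- //|/IH uh].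
by rewrite (path_nodes_edge u xh) uh orbT.
Qed.

Lemma path_nodes_total w u v : u \in path_nodes w -> v \in path_nodes w ->
  (u \in path_nodes v) || (v \in path_nodes u).
Proof.
elim/node_ind: w => [|x h a xh IH].
  by rewrite path_nodesE root_inedge !inE => /eqP-> /eqP->; rewrite path_nodes_refl.
move=> ux vx; have := ux; rewrite (path_nodes_edge u xh).
case/predU1P=> [->|uh]; first by rewrite vx orbT.
have := vx; rewrite (path_nodes_edge v xh).
by case/predU1P=> [->|vh]; [rewrite ux | exact: IH].
Qed.

Lemma history_edge x h a : (h, a) \in history x ->
  a \in node_actions h /\ h \in path_nodes x.
Proof.
elim/node_ind: x => [|x k b xk IH]; rewrite historyE ?root_inedge // xk.
rewrite (path_nodes_edge h xk) mem_rcons inE.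
case/predU1P=> [[-> ->]|/IH[-> ->]]; last by rewrite orbT.
by rewrite path_nodes_refl orbT inE; split=> //; apply/existsP; exists x; rewrite xk.
Qed.

Lemma infoset_ofP i h : h \in player_nodes G i ->
  infoset_of i h \in infosets G i /\ h \in infoset_of i h.
Proof.
have /and3P[/eqP cov _ _] := infosets_partition G i.
by rewrite /player_nodes -cov => hc; rewrite pblock_mem ?mem_pblock.
Qed.

Lemma infoset_neq0 i I : I \in infosets G i -> exists h, h \in I.
Proof.
have /and3P[_ _ /negP n0] := infosets_partition G i => Ii.
by apply/set0Pn; apply/eqP => I0; rewrite I0 in Ii.
Qed.

Lemma infoset_historyE i I h : perfect_recall G -> I \in infosets G i ->
  h \in I -> infoset_history i I = own_history i h.
Proof.
move=> pr Ii hI; rewrite /infoset_history; case: pickP => [k kI|/(_ h)].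
  exact: pr Ii _ _.
by rewrite hI.
Qed.

Lemma actionsE i I h : I \in infosets G i -> h \in I ->
  actions I = node_actions h.
Proof.
move=> Ii hI; apply/eqP; rewrite eqEsubset (bigcup_sup h) // andbT.
by apply/bigcupsP => k kI; rewrite (infosets_same_actions Ii kI hI).
Qed.

Lemma parent_seqP i I h : perfect_recall G -> I \in infosets G i -> h \in I ->
  parent_seq i I = None \/
  exists k a, [/\ k \in player_nodes G i, k \in path_nodes h,
    a \in node_actions k & parent_seq i I = Some (infoset_of i k, a)].
Proof.
move=> pr Ii hI; rewrite /parent_seq (infoset_historyE pr Ii hI).
have sub e : e \in own_history i h -> exists k a, [/\ k \in player_nodes G i,
    k \in path_nodes h, a \in node_actions k & e = (infoset_of i k, a)].
  case/mapP => -[k a]; rewrite mem_filter => /andP[ki /history_edge[ak kh]] ->.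
  by exists k, a.
elim/last_ind: (own_history i h) sub => [|l e _] sub; first by left.
right; have [|k [a [ki kh ak ->]]] := sub e; first by rewrite mem_rcons mem_head.
by exists k, a; rewrite map_rcons last_rcons.
Qed.

Lemma parent_seq_in i I : perfect_recall G -> I \in infosets G i ->
  parent_seq i I \in sequences G i.
Proof.
move=> pr Ii; have [h hI] := infoset_neq0 Ii; rewrite !inE.
have [->|[k [a [ki _ ak ->]]]] := parent_seqP pr Ii hI; first by [].
have [ii ik] := infoset_ofP ki; apply/orP; right; apply/imsetP.
by exists (infoset_of i k, a) => //; rewrite inE ii (actionsE ii ik).
Qed.

Lemma seq_in i I a : I \in infosets G i -> a \in actions I ->
  Some (I, a) \in sequences G i.
Proof.
move=> Ii aI; rewrite !inE; apply/orP; right; apply/imsetP.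
by exists (I, a) => //; rewrite inE Ii.
Qed.

Lemma connectedC I J : connected I J = connected J I.
Proof.
by apply/existsP/existsP => -[u /andP[uI /existsP[v /andP[vJ uv]]]];
  exists v; rewrite vJ; apply/existsP; exists u; rewrite uI orbC.
Qed.

Lemma connected_parent i I J K a : perfect_recall G -> I \in infosets G i ->
  parent_seq i I = Some (K, a) -> connected I J -> connected K J.
Proof.
move=> pr Ii ps /existsP[u /andP[uI /existsP[v /andP[vJ uv]]]].
have [|[k [b [ki ku _]]]] := parent_seqP pr Ii uI; rewrite ps // => -[-> _].
apply/existsP; exists k; rewrite (infoset_ofP ki).2; apply/existsP; exists v.
rewrite vJ /=; case/orP: uv => [uv|vu]; last exact: path_nodes_total ku vu.
by rewrite (path_nodes_trans ku uv).
Qed.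

Lemma info_seq_relevantP I1 (s2 : sequence G) : perfect_recall G ->
  I1 \in infosets G P1 -> s2 \in sequences G P2 -> info_seq_relevant I1 s2 ->
  (parent_seq P1 I1, s2) \in relevant_pairs G /\
  {in actions I1, forall a, (Some (I1, a), s2) \in relevant_pairs G}.
Proof.
move=> pr Ii s2S rel; split=> [|a aI].
  rewrite inE /= parent_seq_in // s2S /=.
  case ps: (parent_seq _ _) => [[K b]|] //.
  by case: s2 rel {s2S} => [[J c]|] //=; apply: connected_parent ps.
by rewrite inE /= seq_in // s2S.
Qed.

Lemma seq_info_relevantP I2 (s1 : sequence G) : perfect_recall G ->
  I2 \in infosets G P2 -> s1 \in sequences G P1 -> seq_info_relevant s1 I2 ->
  (s1, parent_seq P2 I2) \in relevant_pairs G /\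
  {in actions I2, forall a, (s1, Some (I2, a)) \in relevant_pairs G}.
Proof.
move=> pr Ii s1S rel; split=> [|a aI].
  rewrite inE /= parent_seq_in // s1S /=.
  case ps: (parent_seq _ _) => [[K b]|]; case: s1 rel {s1S} => [[J c]|] //=.
  by rewrite ![connected J _]connectedC; apply: connected_parent ps.
by rewrite inE /= seq_in // s1S.
Qed.

End Facts.

(* Main.v *)
(** The correlation map is linear, so an extreme point of its image is the image
of a single pair of plans, which has 0/1 entries. Conversely, the image always
lies in the von Stengel-Forges polytope V, and V, being bounded, is generated by
its vertices. A 0/1 point v of V is the image of one pair of plans: its marginals
v[-, None] and v[None, -] choose exactly one action at each reachable information
set, which defines the plans, and v[s1, s2] = v[s1, None] v[None, s2] follows by
induction on s1 from the constraints of Player 1. *)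

Require Import Defs.
From mathcomp Require Import boolp classical_sets reals.
From mathcomp Require Import all_boot all_order all_algebra.
From mathcomp Require Import ring lra.
Import Order.TTheory GRing.Theory Num.Theory.
Local Open Scope ring_scope.

Set Implicit Arguments.
Unset Strict Implicit.
Unset Printing Implicit Defensive.

(** * Generation of a bounded polytope by its vertices *)

Section Vertices.
Variables (R : realType) (I : finType).
Implicit Types (A C : set {ffun I -> R^o}) (v y z : {ffun I -> R^o}).

(* As A is bounded, some coordinate decreases along y - z; the first one to
vanish leaves the support. *)
Lemma exit_face A v y z :
  (forall u i, A u -> 0 <= u i <= 1) ->
  (forall s, (forall i, 0 <= (v + s *: (y - z)) i) -> A (v + s *: (y - z))) ->
  A v -> y <> z -> (forall i, v i = 0 -> y i = z i) ->
  exists s, [/\ 0 < s, A (v + s *: (y - z))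
    & (#|support (v + s *: (y - z))%R| < #|support v|)%N].
Proof.
move=> A01 Aclosed Av yz supp.
have E s i : (v + s *: (y - z)) i = v i + s * (y i - z i) by rewrite !ffunE.
have v0 i : 0 <= v i by case/andP: (A01 _ i Av).
have [i0 di0] : exists i0, y i0 - z i0 < 0.
  (* Otherwise y - z is nonnegative and nonzero, and moving from [v] by 2 / (y i - z i) raises
     coordinate i by 2, beyond the bound 1. *)
  apply: contrapT => noneg.
  have d0 i : 0 <= y i - z i.
    by rewrite leNgt; apply/negP => di; apply: noneg; exists i.
  apply: yz; apply/ffunP => i; apply/eqP; rewrite -subr_eq0; apply/negPn/negP => di.
  have dpos : 0 < y i - z i by rewrite lt_neqAle eq_sym di d0.
  have s0 : 0 <= 2 / (y i - z i) by rewrite divr_ge0.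
  have /(A01 _ i)/andP[_] : A (v + (2 / (y i - z i)) *: (y - z)).
    by apply: Aclosed => j; rewrite E addr_ge0 ?v0 // mulr_ge0 // d0.
  by rewrite E divfK //; have := v0 i; lra.
(* [ratio i] is the step at which a decreasing coordinate i vanishes. It is positive, because [y]
   and [z] agree wherever [v] is zero. *)
pose ratio i := v i / (z i - y i).
case: (@Order.TotalTheory.arg_minP _ _ _ i0 (fun i => y i - z i < 0) ratio di0) => j dj jmin.
have vj : 0 < v j.
  rewrite lt_neqAle v0 andbT eq_sym; apply/eqP => /supp yzj.
  by move: dj; rewrite yzj subrr ltxx.
have zy : z j - y j != 0 by apply: lt0r_neq0; lra.
exists (ratio j); have rpos : 0 < ratio j by apply: divr_gt0 => //; lra.
split=> //.
- apply: Aclosed => i; rewrite E; case: (ltP (y i - z i) 0) => di; last first.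
    by rewrite addr_ge0 ?v0 // mulr_ge0 // ltW.
  have := jmin i di; rewrite {2}/ratio ler_pdivlMr; last lra.
  lra.
- apply: proper_card; apply/properP; split.
    apply/subsetP => i; rewrite !inE; apply: contra => /eqP vi.
    by rewrite E vi (supp _ vi) subrr mulr0 addr0.
  exists j; rewrite !inE; first by rewrite gt_eqF.
  rewrite negbK E /ratio; apply/eqP; field.
  exact: zy.
Qed.

(** Induction on the size of the support. A point that is not a vertex lies inside a proper segment;
    following its direction both ways until a coordinate vanishes gives two points of smaller
    support with [v] between them. The closure hypothesis is the form that linear equations plus
    nonnegativity take. *)
Lemma vertices_generate A C :
  (forall v i, A v -> 0 <= v i <= 1) ->
  (forall v y z s, A v -> A y -> A z ->
     (forall i, 0 <= (v + s *: (y - z)) i) -> A (v + s *: (y - z))) ->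
  (forall y z t, C y -> C z -> 0 <= t <= 1 -> C (t *: y + (1 - t) *: z)) ->
  (forall v, vertex A v -> C v) ->
  forall v, A v -> C v.
Proof.
move=> A01 Aclosed Cconv vertC v.
have [n] := ubnP #|support v|; elim: n v => // n IH v ltn Av.
have [vx|nvx] := pselect (vertex A v); first exact: vertC.
have [y [z [t [Ay Az /andP[t0 t1] vE yz]]]] :
    exists y z t, [/\ A y, A z, 0 < t < 1, v = t *: y + (1 - t) *: z & y <> z].
  apply: contrapT => nex; apply: nvx; split=> // y z t Ay Az t01 vE.
  have yz : y = z by apply: contrapT => yz; apply: nex; exists y, z, t.
  by rewrite vE -yz -scalerDl addrC subrK scale1r.
(* A mixture of nonnegative numbers with positive weights is zero only if both are. *)
have supp i : v i = 0 -> y i = z i.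
  have /andP[y0 _] := A01 _ i Ay; have /andP[z0 _] := A01 _ i Az.
  rewrite vE !ffunE => v0.
  have ty0 : 0 <= t * y i by rewrite mulr_ge0 // ltW.
  have tz0 : 0 <= (1 - t) * z i by rewrite mulr_ge0 // subr_ge0 ltW.
  have /eqP : t * y i = 0 by move: v0 ty0 tz0; rewrite /GRing.scale /=; lra.
  have /eqP : (1 - t) * z i = 0 by move: v0 ty0 tz0; rewrite /GRing.scale /=; lra.
  rewrite !mulf_eq0 subr_eq0 (gt_eqF t0) (gt_eqF t1) /=.
  by move=> /eqP-> /eqP->.
have Aray y' z' s : A y' -> A z' -> (forall i, 0 <= (v + s *: (y' - z')) i) ->
    A (v + s *: (y' - z')) by apply: Aclosed.
have [s [s0 As lts]] := exit_face A01 (fun s => @Aray y z s Ay Az) Av yz supp.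
have [r [r0 Ar ltr]] := exit_face A01 (fun s => @Aray z y s Az Ay) Av
  (fun zy => yz (esym zy)) (fun i vi0 => esym (supp i vi0)).
have sr : s + r != 0 by rewrite gt_eqF // addr_gt0.
(* With these weights the opposite shifts by [s] and [r] cancel. *)
have -> : v = (r / (s + r)) *: (v + s *: (y - z))
            + (1 - r / (s + r)) *: (v + r *: (z - y)).
  by apply/ffunP => i; rewrite !ffunE /GRing.scale /=; field.
apply: Cconv; first 2 last.
- by rewrite divr_ge0 ?ler_pdivrMr ?addr_gt0 // ?mul1r ?lerDr ltW // addr_gt0.
- by apply: IH As; apply: leq_trans lts _.
- by apply: IH Ar; apply: leq_trans ltr _.
Qed.

End Vertices.

(** * Sequences and plans of one player *)

Section Sequences.
Variables (G : game) (i : player).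
Hypothesis hrecall : perfect_recall G.
Implicit Types (I : {set node G}) (s : sequence G) (pl : plan G i).

(** The last own move above x is made at the deepest node k of the player strictly above x, and the
    earlier moves form the own history of k. *)
Lemma own_historyP (x : node G) : own_history i x = [::] \/
  exists k a, [/\ k \in player_nodes G i, a \in node_actions k &
    own_history i x = rcons (own_history i k) (infoset_of i k, a)].
Proof.
elim/node_ind: x => [|x h a xh IH].
  by left; rewrite /own_history historyE root_inedge.
rewrite {1 2}/own_history historyE xh filter_rcons /=.
case: ifP => hi; last exact: IH.
right; exists h, a; split=> //; last by rewrite map_rcons.
by rewrite inE; apply/existsP; exists x; rewrite xh.
Qed.

(** By perfect recall the own history of one node is that of its whole information set, so the last
    pair of a history determines all of it. *)
Lemma seq_path_parent I : I \in infosets G i ->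
  seq_path i (parent_seq i I) = infoset_history i I.
Proof.
move=> Ii; have [h hI] := infoset_neq0 Ii.
rewrite /parent_seq (infoset_historyE hrecall Ii hI).
have [->//|[k [a [ki ak ->]]]] := own_historyP h.
have [iI kI] := infoset_ofP ki.
by rewrite map_rcons last_rcons /= (infoset_historyE hrecall iI kI).
Qed.

Lemma sequencesP s : reflect
  (s = None \/ exists I a, [/\ s = Some (I, a), I \in infosets G i & a \in actions I])
  (s \in sequences G i).
Proof.
rewrite !inE; apply: (iffP orP) => [[/eqP->|/imsetP[[I a]]]|[->|[I [a [-> Ii aI]]]]].
- by left.
- by rewrite inE /= => /andP[Ii aI] ->; right; exists I, a.
- by left.
- by right; apply/imsetP; exists (I, a) => //; rewrite inE Ii.
Qed.

(** Well-founded because passing to the parent sequence removes the last pair of [seq_path]. *)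
Lemma sequence_ind (P : sequence G -> Prop) : P None ->
  (forall I a, I \in infosets G i -> a \in actions I ->
     P (parent_seq i I) -> P (Some (I, a))) ->
  {in sequences G i, forall s, P s}.
Proof.
move=> P0 PS s; have [n] := ubnP (size (seq_path i s)).
elim: n s => // n IH s ltn /sequencesP[->//|[I [a [sE Ii aI]]]].
rewrite sE; apply: PS => //; apply: IH; last exact: parent_seq_in.
by rewrite seq_path_parent //; move: ltn; rewrite sE /= size_rcons ltnS.
Qed.

Lemma plans_of_parent pl I : I \in infosets G i ->
  (pl \in plans_of i (parent_seq i I)) = reachable i (val pl) I.
Proof. by move=> Ii; rewrite inE seq_path_parent. Qed.

Lemma plans_of_Some pl I a : I \in infosets G i ->
  (pl \in plans_of i (Some (I, a)))
    = (pl \in plans_of i (parent_seq i I)) && (val pl I == Some a).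
Proof. by move=> Ii; rewrite plans_of_parent // inE /= all_rcons andbC. Qed.

(** A plan that follows the parent sequence reaches [I] and picks exactly one action there; for any
    other plan all terms vanish. *)
Lemma sum_plans_of (R : realType) pl I : I \in infosets G i ->
  \sum_(a in actions I) (pl \in plans_of i (Some (I, a)))%:R
    = (pl \in plans_of i (parent_seq i I))%:R :> R.
Proof.
move=> Ii; under eq_bigr => a _ do rewrite plans_of_Some //.
case reach: (pl \in _) => /=; last by rewrite big1.
have /forallP/(_ I) := valP pl; rewrite Ii -plans_of_parent // reach /=.
case/existsP=> b /andP[bI /eqP plb].
rewrite (bigD1 b) //= plb eqxx big1 ?addr0 // => a /andP[_ ab].
by rewrite eqE /= eq_sym (negPf ab).
Qed.

(** Meant for [q] a row or a column of a vector of the polytope, the sequence of the other player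
    being fixed. *)
Lemma le_marginal (R : realType) (q : sequence G -> R) :
  (forall I a, I \in infosets G i -> a \in actions I ->
     q (Some (I, a)) <= q (parent_seq i I)) ->
  {in sequences G i, forall s, q s <= q None}.
Proof. by move=> qS; apply: sequence_ind => // I a Ii aI; apply: le_trans (qS _ _ Ii aI). Qed.

Lemma le_parent (R : realType) (q : sequence G -> R) I a :
  (forall b, b \in actions I -> 0 <= q (Some (I, b))) ->
  \sum_(b in actions I) q (Some (I, b)) = q (parent_seq i I) ->
  a \in actions I -> q (Some (I, a)) <= q (parent_seq i I).
Proof.
move=> q0 <- aI; rewrite (bigD1 a) //= lerDl.
by apply: sumr_ge0 => b /andP[/q0].
Qed.

(** * Realization plans with 0/1 values *)

Section ZeroOne.
Variables (R : realType) (q : sequence G -> R).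
Hypothesis q01 : {in sequences G i, forall s, q s = 0 \/ q s = 1}.
Hypothesis q_root : q None = 1.
Hypothesis q_sum : forall I, I \in infosets G i ->
  \sum_(a in actions I) q (Some (I, a)) = q (parent_seq i I).

Lemma zero_one_ge0 I a : I \in infosets G i -> a \in actions I ->
  0 <= q (Some (I, a)).
Proof. by move=> Ii aI; have [->|->] := q01 (seq_in Ii aI). Qed.

(** Two actions of value 1 would make the sum at least 2, but the parent has value at most 1. *)
Lemma zero_one_unique I a b : I \in infosets G i ->
  a \in actions I -> b \in actions I ->
  q (Some (I, a)) = 1 -> q (Some (I, b)) = 1 -> a = b.
Proof.
move=> Ii aI bI qa qb; apply/eqP/negPn/negP => ab.
have := q_sum Ii; rewrite (bigD1 a) //= (bigD1 b) /=; last by rewrite bI eq_sym.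
rewrite qa qb.
have : 0 <= \sum_(c | (c \in actions I) && (c != a) && (c != b)) q (Some (I, c)).
  by apply: sumr_ge0 => c /andP[/andP[cI _] _]; apply: zero_one_ge0.
by have [->|->] := q01 (parent_seq_in hrecall Ii); lra.
Qed.

Lemma zero_one_exists I : I \in infosets G i -> q (parent_seq i I) = 1 ->
  exists2 a, a \in actions I & q (Some (I, a)) = 1.
Proof.
move=> Ii qI; apply: contrapT => nex.
have := q_sum Ii; rewrite qI big1 => [|a aI]; first lra.
by have [//|q1] := q01 (seq_in Ii aI); case: nex; exists a.
Qed.

(** The plan takes at each information set the action of value 1. By induction along sequences, [q]
    is 1 exactly on those whose choices it makes, so it is defined exactly at the information sets
    that it reaches. *)
Lemma zero_one_plan : exists pl : plan G i,
  {in sequences G i, forall s, q s = (pl \in plans_of i s)%:R}.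
Proof.
pose f := [ffun I => if I \in infosets G i
  then [pick a in actions I | q (Some (I, a)) == 1] else None].
have fE I a : I \in infosets G i -> a \in actions I ->
    (f I == Some a) = (q (Some (I, a)) == 1).
  move=> Ii aI; rewrite ffunE Ii; case: pickP => [b /andP[bI /eqP qb]|/(_ a)].
    rewrite eqE /=; apply/eqP/eqP => [<-//|qa]; exact: zero_one_unique Ii bI aI qb qa.
  by rewrite aI /= => ->.
have qf : {in sequences G i, forall s,
    q s = (all (fun p => f p.1 == Some p.2) (seq_path i s))%:R}.
  apply: sequence_ind => [|I a Ii aI]; first by rewrite q_root.
  rewrite seq_path_parent // /= all_rcons /= fE //.
  case: (q01 (seq_in Ii aI)) => qa qI; first by rewrite qa eq_sym oner_eq0.
  rewrite qa eqxx /= -qI.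
  (* Value 1 at an action forces value 1 at the parent sequence. *)
  have := le_parent (fun b => @zero_one_ge0 I b Ii) (q_sum Ii) aI.
  by rewrite qa; case: (q01 (parent_seq_in hrecall Ii)) => ->; rewrite ?ler10.
have pl_plan : is_plan i f.
  apply/forallP => I; case: ifP => [/andP[Ii]|].
    rewrite /reachable -seq_path_parent // => reach.
    have [|a aI qa] := zero_one_exists Ii; first by rewrite qf ?parent_seq_in ?reach.
    by apply/existsP; exists a; rewrite aI fE // qa eqxx.
  move/negbT; rewrite ffunE negb_and; case: ifP => //= Ii.
  rewrite /reachable -seq_path_parent // => nreach.
  case: pickP => // a /andP[aI /eqP qa].
  (* An action of value 1 would give the parent value 1, but it is 0 since [I] is not reached. *)
  have := le_parent (fun b => @zero_one_ge0 I b Ii) (q_sum Ii) aI.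
  by rewrite qa qf ?parent_seq_in // (negPf nreach) ler10.
by exists (exist _ f pl_plan) => s /qf ->; rewrite inE.
Qed.

End ZeroOne.
End Sequences.

(** * Bounds and affine structure of the von Stengel-Forges polytope *)

Section Polytopes.
Variables (R : realType) (G : game).
Hypothesis hrecall : perfect_recall G.
Implicit Types (v : vec G R) (p : relpair G) (s : sequence G).
Implicit Types mu nu : {ffun plan G P1 * plan G P2 -> R}.

Let V := vonStengelForges G R.
Let Xi := correlation_plans G R.

Lemma entry_val v p : entry v (val p).1 (val p).2 = v p.
Proof. by rewrite /entry -surjective_pairing valK. Qed.

Lemma entry_shift v y z r s1 s2 : entry (v + r *: (y - z)) s1 s2
  = entry v s1 s2 + r * (entry y s1 s2 - entry z s1 s2).
Proof.
rewrite /entry; case: insubP => [p _ _|_]; last by rewrite subrr mulr0 addr0.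
by rewrite !ffunE.
Qed.

Lemma entry_ge0 v s1 s2 : (forall p, 0 <= v p) -> 0 <= entry v s1 s2.
Proof. by move=> v0; rewrite /entry; case: insub. Qed.

Lemma entry_irrelevant v s1 s2 : ~~ relevant s1 s2 -> entry v s1 s2 = 0.
Proof.
by move=> irr; rewrite /entry insubF // inE /= (negPf irr) !andbF.
Qed.

(** With [s2] fixed, an entry is at most that of the parent sequence: by the constraint of Player 1
    if the pair is relevant, and because the default entry is 0 otherwise. *)
Lemma entry_le_marginal1 v s1 s2 : V v -> s1 \in sequences G P1 ->
  s2 \in sequences G P2 -> entry v s1 s2 <= entry v None s2.
Proof.
move=> [v0 _ sum1 _] s1S s2S; move: s1 s1S.
apply: (@le_marginal G P1 hrecall R (fun s1 => entry v s1 s2)) => I a Ii aI.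
case rel: (info_seq_relevant I s2); last first.
  by rewrite entry_irrelevant ?entry_ge0 //; case: s2 rel {s2S} => [[]|] //= ? ? ->.
apply: (le_parent (q := fun s => entry v s s2)) (sum1 _ _ Ii s2S rel) aI => b _.
exact: entry_ge0.
Qed.

Lemma entry_le_marginal2 v s1 s2 : V v -> s1 \in sequences G P1 ->
  s2 \in sequences G P2 -> entry v s1 s2 <= entry v s1 None.
Proof.
move=> [v0 _ _ sum2] s1S s2S; move: s2 s2S.
apply: (@le_marginal G P2 hrecall R (entry v s1)) => I a Ii aI.
case rel: (seq_info_relevant s1 I); last first.
  by rewrite entry_irrelevant ?entry_ge0 //; case: s1 rel {s1S} => [[]|] //= ? ? ->.
apply: (le_parent (q := entry v s1)) (sum2 _ _ Ii s1S rel) aI => b _.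
exact: entry_ge0.
Qed.

Lemma empty_seq_in i : None \in sequences G i.
Proof. by rewrite !inE. Qed.

Lemma relpair_in p : [/\ (val p).1 \in sequences G P1,
  (val p).2 \in sequences G P2 & relevant (val p).1 (val p).2].
Proof. by have := valP p; rewrite inE => /and3P. Qed.

Lemma vonStengelForges_bound v p : V v -> 0 <= v p <= 1.
Proof.
move=> Vv; have [v0 v1 _ _] := Vv; rewrite v0 -entry_val -v1.
have [s1S s2S _] := relpair_in p.
apply: le_trans (entry_le_marginal2 Vv (empty_seq_in _) s2S).
exact: entry_le_marginal1.
Qed.

(** The difference y - z satisfies the homogeneous constraints, so only nonnegativity could fail. *)
Lemma vonStengelForges_shift v y z r : V v -> V y -> V z ->
  (forall p, 0 <= (v + r *: (y - z)) p) -> V (v + r *: (y - z)).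
Proof.
move=> [_ v1 sv1 sv2] [_ y1 sy1 sy2] [_ z1 sz1 sz2] ge0; split=> //.
- by rewrite entry_shift v1 y1 z1 subrr mulr0 addr0.
- move=> I s Ii sS rel; under eq_bigr => a _ do rewrite entry_shift.
  by rewrite big_split -mulr_sumr sumrB sv1 // sy1 // sz1 // entry_shift.
- move=> I s Ii sS rel; under eq_bigr => a _ do rewrite entry_shift.
  by rewrite big_split -mulr_sumr sumrB sv2 // sy2 // sz2 // entry_shift.
Qed.

(** * The correlation map and its image *)

Lemma correlation_mapE mu p : correlation_map mu p =
  \sum_pl mu pl * ((pl.1 \in plans_of P1 (val p).1)%:R
                   * (pl.2 \in plans_of P2 (val p).2)%:R).
Proof.
rewrite ffunE pair_big big_mkcond; apply: eq_bigr => -[pl1 pl2] _ /=.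
by do 2!case: (_ \in plans_of _ _); rewrite ?mulr1 ?mulr0.
Qed.

Lemma entry_correlation_map mu s1 s2 : (s1, s2) \in relevant_pairs G ->
  entry (correlation_map mu) s1 s2 =
  \sum_pl mu pl * ((pl.1 \in plans_of P1 s1)%:R * (pl.2 \in plans_of P2 s2)%:R).
Proof.
rewrite /entry; case: insubP => [p _ pE _|/negPf-> //].
by rewrite correlation_mapE pE.
Qed.

(** Each single pair of plans satisfies the constraints, and these are preserved by averaging over
    [mu]. *)
Lemma correlation_plans_sub v : Xi v -> V v.
Proof.
case=> mu [mu0 mu1] <-; split.
- move=> p; rewrite correlation_mapE; apply: sumr_ge0 => pl _.
  by rewrite !mulr_ge0.
- rewrite entry_correlation_map ?inE // -[RHS]mu1; apply: eq_bigr => pl _.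
  by rewrite !inE /= !mulr1.
- move=> I s Ii sS rel.
  have [relp rela] := info_seq_relevantP hrecall Ii sS rel.
  rewrite entry_correlation_map //.
  under eq_bigr => a aI do rewrite (entry_correlation_map _ (rela a aI)).
  rewrite exchange_big; apply: eq_bigr => pl _ /=.
  by rewrite -mulr_sumr -mulr_suml sum_plans_of.
- move=> I s Ii sS rel.
  have [relp rela] := seq_info_relevantP hrecall Ii sS rel.
  rewrite entry_correlation_map //.
  under eq_bigr => a aI do rewrite (entry_correlation_map _ (rela a aI)).
  rewrite exchange_big; apply: eq_bigr => pl _ /=.
  by rewrite -!mulr_sumr sum_plans_of.
Qed.

(** * Point masses and the vertices of the image *)

Definition pure (pl : plan G P1 * plan G P2) : {ffun plan G P1 * plan G P2 -> R} :=
  [ffun pl' => (pl' == pl)%:R].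

Lemma pure_distribution pl : distributions (pure pl).
Proof.
split=> [pl'|]; first by rewrite ffunE.
rewrite (bigD1 pl) //= ffunE eqxx big1 ?addr0 // => pl' /negPf npl.
by rewrite ffunE npl.
Qed.

Lemma correlation_pure pl p : correlation_map (pure pl) p =
  (pl.1 \in plans_of P1 (val p).1)%:R * (pl.2 \in plans_of P2 (val p).2)%:R.
Proof.
rewrite correlation_mapE (bigD1 pl) //= ffunE eqxx mul1r big1 ?addr0 //.
by move=> pl' /negPf npl; rewrite ffunE npl mul0r.
Qed.

Lemma correlation_map_combine a b mu nu :
  correlation_map [ffun pl => a * mu pl + b * nu pl]
  = a *: correlation_map mu + b *: correlation_map nu.
Proof.
apply/ffunP => p; transitivity (a * correlation_map mu p + b * correlation_map nu p); last first.
  by rewrite !ffunE.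
rewrite !correlation_mapE !mulr_sumr -big_split.
by apply: eq_bigr => pl _; rewrite ffunE /=; ring.
Qed.

Lemma correlation_plans_convex y z t : Xi y -> Xi z -> 0 <= t <= 1 ->
  Xi (t *: y + (1 - t) *: z).
Proof.
move=> [mu [mu0 mu1] <-] [nu [nu0 nu1] <-] /andP[t0 t1].
exists [ffun pl => t * mu pl + (1 - t) * nu pl]; last exact: correlation_map_combine.
split=> [pl|]; first by rewrite ffunE addr_ge0 // mulr_ge0 // subr_ge0.
under eq_bigr => pl _ do rewrite ffunE.
by rewrite big_split /= -!mulr_sumr mu1 nu1; ring.
Qed.

(** A preimage [mu] is a proper mixture of the point mass at a pair in its support and a remainder
    [nu]; by linearity and extremality the point mass also maps to [v]. *)
Lemma vertex_correlation_plans v : vertex Xi v ->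
  exists pl, v = correlation_map (pure pl).
Proof.
case=> -[mu [mu0 mu1] <-] ext.
have [pl mupl] : exists pl, mu pl != 0.
  apply: contrapT => nex; have /eqP := mu1; rewrite big1 ?(eq_sym 0) ?oner_eq0 //.
  by move=> pl _; apply/eqP/negPn/negP => npl; apply: nex; exists pl.
have mu_gt0 : 0 < mu pl by rewrite lt_neqAle eq_sym mupl mu0.
have mu_le1 : mu pl <= 1.
  by rewrite -mu1 (bigD1 pl) //= lerDl sumr_ge0.
(* Half of the weight, so that t < 1 even if mu is already pure. *)
pose t := mu pl / 2.
have t1 : 1 - t != 0 by rewrite /t; apply: lt0r_neq0; lra.
(* The normalized remainder (mu - t pure) / (1 - t), nonnegative since [t] is at most [mu pl]. *)
pose nu := [ffun pl' => (1 - t)^-1 * mu pl' + (- (t / (1 - t))) * pure pl pl'].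
have muE : mu = [ffun pl' => t * pure pl pl' + (1 - t) * nu pl'].
  by apply/ffunP => pl'; rewrite [RHS]ffunE [nu _]ffunE; field.
have nuD : distributions nu.
  split=> [pl'|].
    rewrite ffunE [_^-1 * _]mulrC mulNr mulrAC -mulrBl mulr_ge0 //; last first.
      by rewrite invr_ge0 /t; lra.
    rewrite ffunE; case: eqP => [->|_]; last by rewrite mulr0 subr0.
    by rewrite /t /=; lra.
  under eq_bigr => pl' _ do rewrite ffunE.
  by rewrite big_split /= -!mulr_sumr mu1 (pure_distribution pl).2; field.
have [||||<- _] := ext (correlation_map (pure pl)) (correlation_map nu) t.
- by exists (pure pl) => //; apply: pure_distribution.
- by exists nu.
- by rewrite /t; apply/andP; split; lra.
- by rewrite {1}muE correlation_map_combine.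
- by exists pl.
Qed.

(** Each entry lies between 0 and both of its marginals, so it equals their product as soon as one
    marginal is 0; [prod] settles the case where both are 1. *)
Lemma zero_one_correlation v : V v -> (forall p, v p = 0 \/ v p = 1) -> Xi v.
Proof.
move=> Vv v01; have [v0 v1 sum1 sum2] := Vv.
have e01 s1 s2 : entry v s1 s2 = 0 \/ entry v s1 s2 = 1.
  by rewrite /entry; case: insub => [p|]; [exact: v01 | left].
have m1 I : I \in infosets G P1 ->
    \sum_(a in actions I) entry v (Some (I, a)) None = entry v (parent_seq P1 I) None.
  by move=> Ii; apply: sum1 => //; apply: empty_seq_in.
have m2 I : I \in infosets G P2 ->
    \sum_(a in actions I) entry v None (Some (I, a)) = entry v None (parent_seq P2 I).
  by move=> Ii; apply: sum2 => //; apply: empty_seq_in.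
have [pl1 pl1E] := zero_one_plan hrecall (fun s _ => e01 s None) v1 m1.
have [pl2 pl2E] := zero_one_plan hrecall (fun s _ => e01 None s) v1 m2.
(* In the induction step the parent entry is 1, so some action b at I has entry 1 with [s2]. Its
   marginal is then 1 too, and uniqueness gives b = a. *)
have prod s2 : s2 \in sequences G P2 -> entry v None s2 = 1 ->
    {in sequences G P1, forall s1, relevant s1 s2 ->
      entry v s1 None = 1 -> entry v s1 s2 = 1}.
  move=> s2S vs2; apply: (sequence_ind hrecall) => // I a Ii aI IH rel va.
  have relI : info_seq_relevant I s2 by case: s2 rel {s2S vs2 IH} => [[]|].
  have relp : relevant (parent_seq P1 I) s2.
    have [] := info_seq_relevantP hrecall Ii s2S relI.
    by rewrite inE => /and3P[].
  have vp : entry v (parent_seq P1 I) None = 1.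
    have := le_parent (q := fun s => entry v s None)
      (fun b _ => entry_ge0 (Some (I, b)) None v0) (m1 _ Ii) aI.
    by rewrite va; case: (e01 (parent_seq P1 I) None) => ->; rewrite ?ler10.
  have [b bI vb] : exists2 b, b \in actions I & entry v (Some (I, b)) s2 = 1.
    apply: contrapT => nex; have := sum1 _ _ Ii s2S relI.
    rewrite (IH relp vp) big1 => [|b bI]; first by move/eqP; rewrite eq_sym oner_eq0.
    by have [//|vb] := e01 (Some (I, b)) s2; case: nex; exists b.
  suff -> : a = b by [].
  apply: (zero_one_unique hrecall (fun s _ => e01 s None) m1 Ii aI bI va).
  have := entry_le_marginal2 Vv (seq_in Ii bI) s2S; rewrite vb.
  by case: (e01 (Some (I, b)) None) => ->; rewrite ?ler10.
exists (pure (pl1, pl2)); first exact: pure_distribution.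
apply/ffunP => p; have [s1S s2S rel] := relpair_in p.
rewrite correlation_pure -pl1E // -pl2E // -entry_val.
have := prod _ s2S _ _ s1S rel.
have := entry_le_marginal1 Vv s1S s2S; have := entry_le_marginal2 Vv s1S s2S.
have := entry_ge0 (val p).1 (val p).2 v0.
case: (e01 (val p).1 None) => ->; case: (e01 None (val p).2) => ->.
- by rewrite mul0r => *; lra.
- by rewrite mul0r => *; lra.
- by rewrite mulr0 => *; lra.
- by rewrite mulr1 => _ _ _ ->.
Qed.

End Polytopes.

Theorem theorem3 (R : realType) (G : game) (hrecall : perfect_recall G) :
  correlation_plans G R = vonStengelForges G R <->
  (forall v : vec G R, vertex (vonStengelForges G R) v ->
     forall p : relpair G, v p = 0 \/ v p = 1).
Proof.
split=> [<- v /vertex_correlation_plans[pl ->] p|v01].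
  rewrite correlation_pure.
  by do 2!case: (_ \in plans_of _ _); rewrite ?mulr1 ?mul0r ?mulr0; auto.
apply/seteqP; split=> v; first exact: correlation_plans_sub.
(* The convex set generated into is the image of the correlation map, which contains every 0/1
   vertex. *)
apply: vertices_generate.
- by move=> u p; apply: vonStengelForges_bound.
- exact: vonStengelForges_shift.
- exact: correlation_plans_convex.
- by move=> u uvert; apply: zero_one_correlation => //; [case: uvert | apply: v01].
Qed.
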